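(* Let $A$ be a Weil algebra with nilpotent ideal $\mathfrak n$, and suppose that the group $\operatorname{Aut} A$ of $\mathbb R$-algebra automorphisms of $A$ is connected in the Euclidean topology. For $\varphi\in\operatorname{Aut}A$ let $\mathfrak D_1(\varphi)\in\mathbb R\setminus\{0\}$ be the determinant of the linear automorphism of $\mathfrak n/\mathfrak n^2$ induced by $\varphi$. Then one of the following two cases holds: (i) $\mathfrak D_1$ is constant on $\operatorname{Aut}A$ with value $1$; (ii) the set of values of $\mathfrak D_1$ on $\operatorname{Aut}A$ is exactly the interval $(0,\infty)$. Moreover, both cases do occur: there exists a Weil algebra with connected automorphism group for which (i) holds, and there exists a Weil algebra with connected automorphism group for which (ii) holds.
   Context: A Weil algebra is a finite-dimensional, commutative, associative, unital local $\mathbb R$-algebra $A$ of the form $A=\mathbb R\cdot 1\oplus\mathfrak n$, where $\mathfrak n$ is the ideal of nilpotent elements of $A$. $\operatorname{Aut}A$ denotes the group of unital $\mathbb R$-algebra automorphisms of $A$, regarded as a subgroup of the general linear group $GL(A)$ of the finite-dimensional real vector space $A$, with the Euclidean subspace topology; ''connected'' means that $\operatorname{Aut}A$ has only one connected component in this topology. Every $\varphi\in\operatorname{Aut}A$ maps $\mathfrak n$ to $\mathfrak n$ and $\mathfrak n^2$ to $\mathfrak n^2$, hence induces an $\mathbb R$-linear automorphism of the finite-dimensional real vector space $\mathfrak n/\mathfrak n^2$ (represented by a matrix $\mathcal M_1$ in a chosen basis), and $\mathfrak D_1(\varphi)=\det\mathcal M_1$ is its determinant (equal to $1$ if $\mathfrak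 n/\mathfrak n^2=0$). *)

(* Defs.v *)
From HB Require Import structures.
From mathcomp Require Import all_boot all_order all_algebra all_field.
From mathcomp Require Import all_classical all_reals all_analysis.

Set Implicit Arguments.
Unset Strict Implicit.
Unset Printing Implicit Defensive.

Import Order.TTheory GRing.Theory Num.Theory.
Import numFieldNormedType.Exports.

Local Open Scope classical_set_scope.
Local Open Scope ring_scope.

(* The predicate [idealr_closed] of ring_quotient.v includes [1 \notin S]:
   it describes the proper ideals. *)
Definition maximal_ideal (A : nzRingType) (S : {pred A}) : Prop :=
  idealr_closed S /\
  forall T : {pred A}, idealr_closed T -> {subset S <= T} -> T =i S.

Definition local_ring (A : nzRingType) : Prop :=
  exists2 S : {pred A}, maximal_ideal S &
    forall T : {pred A}, maximal_ideal T -> T =i S.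

Record weil_algebra (R : realType) (A : falgType R) (n : {vspace A}) : Prop :=
  WeilAlgebra {
    weil_comm : commutative (@GRing.mul A);
    weil_local : local_ring A;
    weil_nilP : forall x : A, x \in n <-> exists k : nat, x ^+ k = 0;
    weil_sum : (1 + n)%VS = fullv;
    weil_direct : directv (1 + n)
  }.

Definition alg_aut (R : realType) (A : falgType R) : set 'End(A) :=
  [set phi : 'End(A) | ahom_in {:A}%VS phi /\ bijective phi].

Definition lfun_mx (R : realType) (V : vectType R) (f : 'End(V)) :
    'M[R]_(\dim {:V}) :=
  passmx.mxof (vbasis {:V}) (vbasis {:V}) f.

Definition lfun_det (R : realType) (V : vectType R) (f : 'End(V)) : R :=
  \det (lfun_mx f).

(* The Euclidean topology of GL(A) is that of the space of matrices over R,
   transported along the coordinates in a basis of A. *)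
Definition connected_aut (R : realType) (A : falgType R) : Prop :=
  connected ((@lfun_mx R A) @` (@alg_aut R A)).

(* The quotient U / V is modelled by a complement of V in U, together with the
   class map [quotv_class] (projection along V); lemmas [quotv_class_eq0] and
   [quotv_class_surj] are its characteristic properties, and
   [quotv_lfun_class] says that [quotv_lfun] is the induced map. *)
Definition quotv (R : realType) (W : vectType R) (U V : {vspace W}) :
    vectType R :=
  subvs_of (U :\: V)%VS.

Definition quotv_class (R : realType) (W : vectType R) (U V : {vspace W}) :
    'Hom(W, quotv U V) :=
  (linfun (vsproj (U :\: V)) \o addv_pi1 U V)%VF.

Definition quotv_lfun (R : realType) (W : vectType R) (U V : {vspace W})
    (f : 'End(W)) : 'End(quotv U V) :=
  (quotv_class U V \o f \o linfun (@vsval _ _ (U :\: V)%VS))%VF.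

Lemma addv_pi1_diff (R : realType) (W : vectType R) (U V : {vspace W}) (x : W) :
  addv_pi1 U V x \in (U :\: V)%VS.
Proof. exact: memv_pi. Qed.

Lemma val_quotv_class (R : realType) (W : vectType R) (U V : {vspace W}) (x : W) :
  vsval (quotv_class U V x) = addv_pi1 U V x.
Proof. by rewrite comp_lfunE lfunE /= vsprojK // addv_pi1_diff. Qed.

Lemma quotv_class_eq0 (R : realType) (W : vectType R) (U V : {vspace W}) (x : W) :
  x \in U -> (quotv_class U V x == 0) = (x \in V).
Proof.
move=> xU; rewrite -(inj_eq val_inj) /= val_quotv_class.
have xUV : x \in (U + V)%VS by apply: subvP (addvSl _ _) _ xU.
have dUV : x = addv_pi1 U V x + addv_pi2 U V x by rewrite addv_pi1_pi2.
apply/eqP/idP => [p0|xV]; first by rewrite dUV p0 add0r memv_pi2.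
have : addv_pi1 U V x \in (V :&: (U :\: V))%VS.
  rewrite memv_cap addv_pi1_diff andbT.
  have -> : addv_pi1 U V x = x - addv_pi2 U V x by rewrite [X in X - _]dUV addrK.
  by rewrite memvB // memv_pi2.
by rewrite capvC capv_diff memv0 => /eqP.
Qed.

Lemma quotv_class_surj (R : realType) (W : vectType R) (U V : {vspace W})
    (q : quotv U V) :
  vsval q \in U /\ quotv_class U V (vsval q) = q.
Proof.
have qD : vsval q \in (U :\: V)%VS by apply: subvsP.
split; first exact: subvP (diffvSl U V) _ qD.
apply: val_inj; rewrite /= val_quotv_class.
by rewrite /addv_pi1 daddv_pi_id // capv_diff.
Qed.

Lemma quotv_lfun_class (R : realType) (W : vectType R) (U V : {vspace W})
    (f : 'End(W)) (x : W) :
  (f @: V <= V)%VS -> (V <= U)%VS -> (f @: U <= U)%VS -> x \in U ->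
  quotv_lfun U V f (quotv_class U V x) = quotv_class U V (f x).
Proof.
move=> fV sVU fU xU.
have -> q : quotv_lfun U V f q = quotv_class U V (f (vsval q)).
  rewrite /quotv_lfun; move: (quotv_class U V) => c.
  by rewrite !comp_lfunE [linfun _ _]lfunE.
rewrite val_quotv_class; apply/eqP; rewrite -subr_eq0 -linearB /= -linearB /=.
have sp : addv_pi1 U V x - x \in V.
  have xUV : x \in (U + V)%VS by apply: subvP (addvSl _ _) _ xU.
  rewrite -{2}(addv_pi1_pi2 xUV) opprD addrA subrr add0r memvN.
  exact: memv_pi2.
have fsp : f (addv_pi1 U V x - x) \in V by apply: subvP fV _ (memv_img f sp).
by have := quotv_class_eq0 V (subvP sVU _ fsp); rewrite fsp linearB.
Qed.

Definition D1 (R : realType) (A : falgType R) (n : {vspace A})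
    (phi : 'End(A)) : R :=
  lfun_det (quotv_lfun n (n * n)%VS phi).

(* [D1 n phi] is the determinant of the map induced on n / n^2: *)
Lemma quotv_lfun_aut (R : realType) (A : falgType R) (n : {vspace A})
    (phi : 'End(A)) (x : A) :
  weil_algebra n -> alg_aut phi -> x \in n ->
  quotv_lfun n (n * n)%VS phi (quotv_class n (n * n)%VS x) =
  quotv_class n (n * n)%VS (phi x).
Proof.
move=> wn [/ahom_inP[phiM phi1] _] xn.
have phiMt y z : phi (y * z) = phi y * phi z by rewrite phiM ?memvf.
have phiX y k : phi (y ^+ k) = phi y ^+ k.
  by elim: k => [|k IH]; rewrite ?expr0 // !exprS phiMt IH.
have phin y : y \in n -> phi y \in n.
  move=> /(weil_nilP wn)[k yk]; apply/(weil_nilP wn); exists k.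
  by rewrite -phiX yk linear0.
have sub2 : (n * n <= n)%VS.
  apply/prodvP => y z /(weil_nilP wn)[k yk] _.
  apply/(weil_nilP wn); exists k.
  by rewrite exprMn_comm ?yk ?mul0r //; apply: (weil_comm wn).
apply: quotv_lfun_class => //; last first.
  by apply/subvP => _ /memv_imgP[y yn ->]; apply: phin.
have : (n * n <= phi @^-1: (n * n))%VS.
  by apply/prodvP => y z yn zn; rewrite -memv_preim phiMt memv_mul ?phin.
by move=> /subvP sn; apply/subvP => _ /memv_imgP[y /sn yn ->]; rewrite memv_preim.
Qed.

(* Main.v *)
Require Import Defs.
From HB Require Import structures.
From mathcomp Require Import all_boot all_order all_algebra all_field.
From mathcomp Require Import all_classical all_reals all_analysis.
From mathcomp Require Import ring lra.

Import Order.TTheory GRing.Theory Num.Theory.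
Import numFieldNormedType.Exports.

Set Implicit Arguments.
Unset Strict Implicit.
Unset Printing Implicit Defensive.

Local Open Scope classical_set_scope.
Local Open Scope ring_scope.

(** [D1] is a continuous group morphism, so on a connected automorphism group
    its values form a subgroup of the nonzero reals that is an interval: either
    {1} or all positive reals.

    The first case is realised by the algebra R itself. For the second, let X, Y
    and Z be copies of the quaternions and take the algebra
    R + (X + Y) + (R e + Z) whose products of generators are x x' = <x, x'> e,
    x y = xy in Z and y y' = 0. As <,> is definite, Y + R e + Z is the set of
    nilpotents of square zero, hence invariant; so an automorphism f acts on the
    graded pieces by linear maps with P(x) Q(y) = T(xy). By Skolem-Noether these
    are P(x) = r x r^* p and Q(y) = p^* r y r^* s with nonzero quaternions p, r,
    s. The block-diagonal part F of f is an automorphism and D = f - F satisfies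
    D(u) D(v) = 0, so F + t D is an automorphism for all t, which joins f to F;
    F is joined to the identity because the nonzero quaternions are connected.
    (Noncommutativity matters: over the complex numbers, conjugation would give
    a second component.) Doubling X and Y gives a value of [D1] different from
    1. *)

(** * The determinant on n / n^2 *)

Lemma lfun_mx_coord (R : realType) (V : vectType R) (f : 'End(V)) i j :
  lfun_mx f i j = coord (vbasis {:V}) j (f (vbasis {:V})`_i).
Proof. by rewrite !mxE /= passmx.vecof_delta. Qed.

Lemma lfun_mxK (R : realType) (V : vectType R) :
  cancel (@lfun_mx R V) (passmx.hommx (vbasis {:V}) (vbasis {:V})).
Proof. by move=> f; apply: passmx.mxofK; apply: vbasisP. Qed.

Lemma lfun_det_comp (R : realType) (V : vectType R) (f g : 'End(V)) :
  lfun_det (f \o g)%VF = lfun_det f * lfun_det g.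
Proof.
rewrite /lfun_det /lfun_mx (@passmx.mxof_comp _ _ _ _ _ (vbasis {:V})) ?vbasisP //.
by rewrite det_mulmx mulrC.
Qed.

Lemma lfun_det1 (R : realType) (V : vectType R) : lfun_det (\1 : 'End(V))%VF = 1.
Proof.
by rewrite /lfun_det /lfun_mx passmx.mxof1 ?det1 // (basis_free (vbasisP _)).
Qed.

Lemma lfun_det_scale (R : realType) (V : vectType R) (k : R) :
  lfun_det (k *: (\1%VF : 'End(V))) = k ^+ \dim {:V}.
Proof.
suff -> : lfun_det (k *: (\1%VF : 'End(V))) = \det (k%:M : 'M[R]_(\dim {:V})).
  by rewrite det_scalar.
congr (\det _); apply/matrixP => i j; rewrite lfun_mx_coord scale_lfunE id_lfunE.
by rewrite linearZ /= coord_free ?(basis_free (vbasisP _)) // mxE mulr_natr.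
Qed.

Lemma alg_aut1 (R : realType) (A : falgType R) : alg_aut (\1 : 'End(A))%VF.
Proof.
split; last by exists id => x; rewrite id_lfunE.
by apply/ahom_inP; split=> [x y _ _|]; rewrite !id_lfunE.
Qed.

Lemma alg_aut_comp (R : realType) (A : falgType R) (f g : 'End(A)) :
  alg_aut f -> alg_aut g -> alg_aut (f \o g)%VF.
Proof.
move=> [/ahom_inP[fM f1] fb] [/ahom_inP[gM g1] gb]; split.
  apply/ahom_inP; split=> [x y _ _|]; rewrite !comp_lfunE ?g1 //.
  by rewrite gM ?fM ?memvf.
by apply: eq_bij (bij_comp fb gb) _ _ => x; rewrite comp_lfunE.
Qed.

(** In finite dimension an injective endomorphism is invertible, so bijectivity reduces to a trivial
    kernel. *)
Lemma alg_aut_inj (R : realType) (A : falgType R) (f : 'End(A)) :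
  {morph f : x y / x * y} -> f 1 = 1 -> injective f -> alg_aut f.
Proof.
move=> fM f1 fI; split; first by apply/ahom_inP; split => // x y _ _; exact: fM.
have kf : lker f == 0%VS by apply/lker0P.
by exists (f^-1)%VF; [apply: lker0_lfunK | apply: lker0_lfunVK].
Qed.

Lemma alg_autM (R : realType) (A : falgType R) (f : 'End(A)) :
  alg_aut f -> {morph f : x y / x * y}.
Proof. by move=> [/ahom_inP[fM _] _] x y; rewrite fM ?memvf. Qed.

Lemma alg_aut_one (R : realType) (A : falgType R) (f : 'End(A)) :
  alg_aut f -> f 1 = 1.
Proof. by move=> [/ahom_inP[]]. Qed.

Lemma alg_aut_lker (R : realType) (A : falgType R) (f : 'End(A)) :
  alg_aut f -> lker f == 0%VS.
Proof. by move=> [_ fb]; apply/lker0P; apply: bij_inj. Qed.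

Lemma alg_autV (R : realType) (A : falgType R) (f : 'End(A)) :
  alg_aut f -> alg_aut (f^-1)%VF.
Proof.
move=> fa; have kf := alg_aut_lker fa; have fK := lker0_lfunVK kf.
have fI : injective f by apply/lker0P.
apply: alg_aut_inj (can_inj fK) => [x y|]; apply: fI.
  by rewrite (alg_autM fa) !fK.
by rewrite fK (alg_aut_one fa).
Qed.

Section D1_morphism.
Variables (R : realType) (A : falgType R) (n : {vspace A}).
Hypothesis wn : weil_algebra n.

Lemma D1_comp (f g : 'End(A)) : alg_aut f -> alg_aut g ->
  D1 n (f \o g)%VF = D1 n f * D1 n g.
Proof.
move=> fa ga; rewrite /D1 -lfun_det_comp; congr lfun_det.
apply/lfunP => q; have [qn <-] := quotv_class_surj q.
rewrite comp_lfunE !quotv_lfun_aut //; first by rewrite comp_lfunE.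
  (* The image under [g] of a representative must again lie in [n] before [f] can be applied to its
     class; [g] preserves nilpotency with the same exponent. *)
  have [k qk] := (weil_nilP wn _).1 qn; apply/(weil_nilP wn); exists k.
  elim: k {qn} (vsval q) qk => [|k IHk] x.
    by rewrite !expr0 => /eqP; rewrite oner_eq0.
  move=> xk; suff -> : g x ^+ k.+1 = g (x ^+ k.+1) by rewrite xk linear0.
  elim: {xk IHk} k => // k IHk; rewrite exprS IHk -(alg_autM ga).
  by rewrite -exprS.
exact: alg_aut_comp.
Qed.

Lemma D1_id : D1 n \1%VF = 1.
Proof.
rewrite /D1 -[RHS](@lfun_det1 R (quotv n (n * n)%VS)); congr lfun_det.
apply/lfunP => q; have [qn <-] := quotv_class_surj q.
by rewrite quotv_lfun_aut ?id_lfunE //; apply: alg_aut1.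
Qed.

Lemma D1_inv (f : 'End(A)) : alg_aut f -> D1 n f * D1 n (f^-1)%VF = 1.
Proof.
move=> fa; rewrite -D1_comp //; last exact: alg_autV.
by rewrite lker0_compfV ?D1_id // alg_aut_lker.
Qed.

Definition D1_values := [set D1 n f | f in @alg_aut R A].

Lemma D1_valuesX a k : D1_values a -> D1_values (a ^+ k).
Proof.
move=> [f fa <-]; elim: k => [|k [g ga gE]].
  by exists \1%VF; [apply: alg_aut1 | apply: D1_id].
by exists (f \o g)%VF; [apply: alg_aut_comp | rewrite D1_comp // gE exprS].
Qed.

Lemma D1_valuesV a : D1_values a -> D1_values a^-1.
Proof.
move=> [f fa <-]; exists (f^-1)%VF; first exact: alg_autV.
by apply: esym; apply: mulr1_eq; exact: D1_inv.
Qed.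

End D1_morphism.

(** * Continuity of determinants, matrices and [D1], and the dichotomy *)

Section real_continuous.
Variables (R : realType) (T : topologicalType).
Implicit Types f g : T -> R.

Lemma continuous_mulr f g :
  continuous f -> continuous g -> continuous (fun t => f t * g t).
Proof. by move=> fc gc t; apply: (continuousM (fc t) (gc t)). Qed.

Lemma continuous_addr f g :
  continuous f -> continuous g -> continuous (fun t => f t + g t).
Proof. by move=> fc gc t; apply: (continuousD (fc t) (gc t)). Qed.

Lemma continuous_oppr f : continuous f -> continuous (fun t => - f t).
Proof. by move=> fc t; apply: (continuousN (fc t)). Qed.

Lemma continuous_sumr (I : finType) (F : I -> T -> R) :
  (forall i, continuous (F i)) -> continuous (fun t => \sum_i F i t).
Proof.
by move=> Fc; apply: continuous_big => [|i _]; [exact: add_continuous|exact: Fc].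
Qed.

Lemma continuous_prodr (I : finType) (F : I -> T -> R) :
  (forall i, continuous (F i)) -> continuous (fun t => \prod_i F i t).
Proof.
by move=> Fc; apply: continuous_big => [|i _]; [exact: mul_continuous|exact: Fc].
Qed.

Lemma continuous_det m (F : T -> 'M[R]_m) :
  (forall i j, continuous (fun t => F t i j)) -> continuous (fun t => \det (F t)).
Proof.
move=> Fc; apply: continuous_sumr => s.
apply: continuous_mulr; first exact: cst_continuous.
by apply: continuous_prodr => i; exact: Fc.
Qed.

(** A neighbourhood of a matrix contains a product of neighbourhoods of its entries, and finitely
    many conditions near [t] hold simultaneously. *)
Lemma continuous_mx m (F : T -> 'M[R]_m) :
  (forall i j, continuous (fun t => F t i j)) -> continuous F.
Proof.
move=> Fc t B [P PF PB]; rewrite /= /nbhs /=.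
have : \forall x \near t, forall i j, P i j (F x i j).
  have : \forall x \near t, forall ij : 'I_m * 'I_m, P ij.1 ij.2 (F x ij.1 ij.2).
    apply: filter_forall => -[i j] /=.
    exact: (Fc i j t _ (PF i j)).
  by apply: filterS => x xP i j; exact: (xP (i, j)).
by apply: filterS => x xP; exact: PB.
Qed.

End real_continuous.

(** A linear form on matrices is a finite linear combination of the entries. *)
Lemma linear_mx_continuous (R : realType) m (h : 'M[R]_m -> R) :
  linear (h : 'M[R]_m -> R^o) -> continuous h.
Proof.
move=> lh; pose h' := GRing.isLinear.Build _ _ _ _ _ lh.
pose H : {linear 'M[R]_m -> R^o} := HB.pack (h : 'M[R]_m -> R^o) h'.
have -> : h = fun M => \sum_i \sum_j M i j * h (delta_mx i j).
  apply/funext => M; rewrite -[h M]/(H M) {1}(matrix_sum_delta M) linear_sum.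
  apply: eq_bigr => i _; rewrite linear_sum; apply: eq_bigr => j _.
  by rewrite linearZ.
apply: continuous_sumr => i; apply: continuous_sumr => j.
apply: continuous_mulr; [exact: coord_continuous | exact: cst_continuous].
Qed.

(** Each entry of the matrix of the induced map on the quotient is a linear form in [M]. *)
Lemma D1_continuous (R : realType) (A : falgType R) (n : {vspace A}) :
  continuous (fun M => D1 n (passmx.hommx (vbasis {:A}) (vbasis {:A}) M)).
Proof.
apply: continuous_det => i j; apply: linear_mx_continuous => a M N.
rewrite !lfun_mx_coord passmx.hommx_linear /quotv_lfun !comp_lfunE.
by rewrite add_lfunE scale_lfunE !linearP.
Qed.

Lemma D1_values_connected (R : realType) (A : falgType R) (n : {vspace A}) :
  connected_aut A -> connected (D1_values n).
Proof.
move=> cA; pose h M := D1 n (passmx.hommx (vbasis {:A}) (vbasis {:A}) M).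
suff -> : D1_values n = h @` ((@lfun_mx R A) @` (@alg_aut R A)).
  apply: connected_continuous_connected cA _.
  by apply: continuous_subspaceT; exact: D1_continuous.
by rewrite image_comp /D1_values; apply: eq_imagel => f _ /=; rewrite /h lfun_mxK.
Qed.

Lemma D1_dichotomy (R : realType) (A : falgType R) (n : {vspace A}) :
  weil_algebra n -> connected_aut A ->
  (forall phi : 'End(A), alg_aut phi -> D1 n phi = 1) \/
  D1_values n = [set x : R | 0 < x].
Proof.
move=> wn /(@D1_values_connected _ _ n)/connected_intervalP Di.
have [|/existsNP[f /not_implyP[fa /eqP f1]]] :=
  pselect (forall phi : 'End(A), alg_aut phi -> D1 n phi = 1); first by left.
right.
have D1v : D1_values n 1 by exists \1%VF; [exact: alg_aut1 | exact: D1_id].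
have D_neq0 x : D1_values n x -> x != 0.
  move=> [g ga <-]; apply/eqP => g0; have := D1_inv wn ga.
  by rewrite g0 mul0r => /eqP; rewrite eq_sym oner_eq0.
have D_gt0 x : D1_values n x -> 0 < x.
  move=> Dx; rewrite ltNge; apply/negP => x0.
  (* Together with the value 1, a nonpositive value would force 0 into the interval of values. *)
  have /D_neq0 : D1_values n 0 by apply: (Di x 1 Dx D1v); rewrite x0 ler01.
  by rewrite eqxx.
have [a Da a1] : exists2 a, D1_values n a & 1 < a.
  have Df : D1_values n (D1 n f) by exists f.
  case: (ltgtP (D1 n f) 1) f1 => // f1 _; last by exists (D1 n f).
  exists (D1 n f)^-1; first exact: D1_valuesV.
  by rewrite invf_gt1 // D_gt0.
(* The powers of [a] are values, and the Bernoulli bound k (a - 1) <= a^k makes them unbounded. *)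
have large (x : R) : exists2 y, D1_values n y & x <= y.
  have a10 : 0 < a - 1 by rewrite subr_gt0.
  pose k := Num.bound `|x / (a - 1)|; exists (a ^+ k); first exact: D1_valuesX.
  have xk : x <= (a - 1) *+ k.
    rewrite -mulr_natl -ler_pdivrMr //.
    by rewrite (le_trans (ler_norm _)) // ltW // archi_boundP.
  apply: le_trans xk _; elim: k => [|k IHk]; first by rewrite mulr0n expr0.
  rewrite exprS mulrS.
  have ak : 1 <= a ^+ k by rewrite exprn_ege1 // ltW.
  have -> : a * a ^+ k = (a - 1) * a ^+ k + a ^+ k by rewrite mulrBl mul1r subrK.
  by rewrite lerD // ler_peMr // ltW.
apply/seteqP; split=> [x /D_gt0 //|x /= x0].
(* The point [x] is enclosed between the values [z^-1] and [y]. *)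
have [y Dy xy] := large x; have [z Dz xz] := large x^-1.
apply: (Di _ _ (D1_valuesV wn Dz) Dy); rewrite xy andbT.
by rewrite -[x in leRHS]invrK lef_pV2 // posrE ?invr_gt0 // D_gt0.
Qed.

(** * Local algebras with vanishing cube of the maximal ideal *)

Record symbil (R : realType) (V W : vectType R) := SymBil {
  symbil_fun :> V -> V -> W;
  symbilC : forall u v, symbil_fun u v = symbil_fun v u;
  symbilP : forall u, linear (symbil_fun u)
}.

Section symbil_theory.
Variables (R : realType) (V W : vectType R) (b : symbil V W).

Lemma symbilDr u v w : b u (v + w) = b u v + b u w.
Proof. by have := symbilP b u 1 v w; rewrite !scale1r. Qed.

Lemma symbil0r u : b u 0 = 0.
Proof. by apply: (addrI (b u 0)); rewrite -symbilDr !addr0. Qed.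

Lemma symbilZr u a v : b u (a *: v) = a *: b u v.
Proof. by have := symbilP b u a v 0; rewrite !addr0 symbil0r addr0. Qed.

Lemma symbilDl u v w : b (u + v) w = b u w + b v w.
Proof. by rewrite -!(symbilC b w) symbilDr. Qed.

Lemma symbil0l u : b 0 u = 0.
Proof. by rewrite symbilC symbil0r. Qed.

Lemma symbilZl u a v : b (a *: u) v = a *: b u v.
Proof. by rewrite -!(symbilC b v) symbilZr. Qed.

End symbil_theory.

Section two_step_algebra.
Variables (R : realType) (V W : vectType R) (b : symbil V W).

(** The phantom argument gives each form its own type, so that the algebra structure, whose product
    involves the form, can be attached to it. *)
Definition two_step (_ : symbil V W) : Type := (R^o * V * W)%type.

Local Notation T := (two_step b).

HB.instance Definition _ := Vector.on T.

Definition two_step_one : T := (1, 0, 0).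

Definition two_step_mul (u v : T) : T :=
  (u.1.1 * v.1.1 : R, u.1.1 *: v.1.2 + v.1.1 *: u.1.2,
   u.1.1 *: v.2 + v.1.1 *: u.2 + b u.1.2 v.1.2).

Fact two_step_mulC : commutative two_step_mul.
Proof.
move=> [[a v] w] [[a' v'] w']; rewrite /two_step_mul /=.
by rewrite mulrC addrC symbilC [a *: w' + _]addrC.
Qed.

Fact two_step_mulA : associative two_step_mul.
Proof.
move=> [[a v] w] [[a' v'] w'] [[a2 v2] w2]; rewrite /two_step_mul /=.
congr (_, _, _); first by rewrite mulrA.
  by rewrite !scalerDr !scalerA addrA [a2 * a]mulrC [a2 * a']mulrC.
rewrite !symbilDl !symbilDr !symbilZl !symbilZr !scalerDr !scalerA -!addrA.
rewrite [a2 * a]mulrC [a2 * a']mulrC; do 2!congr (_ + _).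
by rewrite addrCA; congr (_ + _); rewrite addrA addrC.
Qed.

Fact two_step_mul1 : left_id two_step_one two_step_mul.
Proof.
move=> [[a v] w]; rewrite /two_step_mul /= mul1r !scale1r !scaler0 !addr0.
by rewrite symbil0l addr0.
Qed.

Fact two_step_mulD : left_distributive two_step_mul +%R.
Proof.
move=> [[a v] w] [[a' v'] w'] [[a2 v2] w2]; rewrite /two_step_mul /=.
congr (_, _, _); rewrite /= ?mulrDl // ?symbilDl !scalerDl !scalerDr !addrA;
  rewrite -!addrA; congr (_ + _).
  by rewrite addrCA.
rewrite addrCA; congr (_ + _); rewrite [RHS]addrCA; congr (_ + _).
by rewrite addrCA.
Qed.

Fact two_step_one_neq0 : two_step_one != 0.
Proof. by apply/eqP => -[/eqP]; rewrite oner_eq0. Qed.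

HB.instance Definition _ := GRing.Zmodule_isComNzRing.Build T
  two_step_mulA two_step_mulC two_step_mul1 two_step_mulD two_step_one_neq0.

Fact two_step_scaleAl (a : R) (u v : T) : a *: (u * v) = (a *: u) * v.
Proof.
case: u v => [[a1 v1] w1] [[a2 v2] w2]; rewrite /GRing.mul /= /two_step_mul /=.
congr (_, _, _); rewrite /= ?symbilZl ?scalerDr ?scalerA.
- by [].
- by rewrite [a * a2]mulrC.
- by rewrite [a * a2]mulrC.
Qed.

HB.instance Definition _ := GRing.Lmodule_isLalgebra.Build R T
  two_step_scaleAl.
HB.instance Definition _ := GRing.Lalgebra_isComAlgebra.Build R T.
HB.instance Definition _ := Algebra_isFalgebra.Build R T.

End two_step_algebra.


(** * Two-step algebras are Weil algebras *)

Section two_step_weil.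
Variables (R : realType) (V W : vectType R) (b : symbil V W).
Local Notation T := (two_step b).

Definition two_step_aug (u : T) : R^o := u.1.1.

Fact two_step_aug_linear : linear two_step_aug.
Proof. by []. Qed.

HB.instance Definition _ := GRing.isLinear.Build R T R^o _ two_step_aug
  two_step_aug_linear.

Definition two_step_nil : {vspace T} := lker (linfun two_step_aug).

Lemma memv_two_step_nil u : (u \in two_step_nil) = (u.1.1 == 0).
Proof. by rewrite memv_ker lfunE. Qed.

Lemma two_step_mulE (u v : T) : u * v =
  (u.1.1 * v.1.1 : R, u.1.1 *: v.1.2 + v.1.1 *: u.1.2,
   u.1.1 *: v.2 + v.1.1 *: u.2 + b u.1.2 v.1.2).
Proof. by []. Qed.

Lemma two_step_augX (u : T) k : (u ^+ k).1.1 = u.1.1 ^+ k :> R.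
Proof. by elim: k => // k IHk; rewrite !exprS two_step_mulE /= IHk. Qed.

Lemma two_step_cube (u : T) : u.1.1 = 0 -> u ^+ 3 = 0.
Proof.
case: u => [[a v] w] /= ->; rewrite !exprS expr0 mulr1 !two_step_mulE /=.
by rewrite !mul0r !scale0r !add0r symbil0r.
Qed.

Lemma two_step_nilP (u : T) : u \in two_step_nil <-> exists k, u ^+ k = 0.
Proof.
rewrite memv_two_step_nil; split=> [/eqP/two_step_cube u0|[k uk]]; first by exists 3%N.
have : u.1.1 ^+ k = 0 :> R by rewrite -two_step_augX uk.
by move=> /eqP; rewrite expf_eq0 => /andP[].
Qed.

(** Up to a nonzero scalar, [u] is 1 - x with x^3 = 0, and the geometric series 1 + x + x^2 inverts
    it. *)
Lemma two_step_unit (u : T) : u.1.1 != 0 -> exists v : T, v * u = 1.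
Proof.
move=> u0; pose x := 1 - (u.1.1)^-1 *: u : T.
have /two_step_cube x3 : x.1.1 = 0 
    by rewrite -[LHS]/(1 - (u.1.1)^-1 * u.1.1 : R) mulVf ?subrr.
have -> : u = u.1.1 *: (1 - x) by rewrite opprB addrC subrK scalerA mulfV ?scale1r.
exists ((u.1.1)^-1 *: (1 + x + x ^+ 2)).
rewrite -scalerAl -scalerAr scalerA mulVf // scale1r.
transitivity (1 - x ^+ 3); last by rewrite x3 subr0.
by move: (x) => y; ring.
Qed.

(** Everything outside the augmentation kernel is a unit, so this kernel contains every proper
    ideal. *)
Lemma two_step_local : local_ring T.
Proof.
pose S : {pred T} := [pred u : T | u.1.1 == 0].
have SI : idealr_closed S.
  split=> [||a u v]; rewrite !inE /= ?eqxx ?oner_eq0 // => /eqP u0 /eqP v0.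
  by rewrite u0 v0 mulr0 addr0.
have sub (I : {pred T}) : idealr_closed I -> {subset I <= S}.
  move=> [I0 I1 II] u uI; rewrite inE; apply: contraNT I1 => /two_step_unit[v uv].
  by rewrite -uv -[v * u]addr0; apply: II.
exists S; first by split=> // I /sub IS SI' u; apply/idP/idP => [/IS|/SI'].
by move=> I [II IM] u; rewrite (IM S) //; exact: sub.
Qed.

Lemma two_step_weil : weil_algebra two_step_nil.
Proof.
split; [exact: mulrC | exact: two_step_local | exact: two_step_nilP | |].
  apply/vspaceP => u; rewrite memvf; apply/memv_addP.
  exists (u.1.1 *: 1); first by apply/vlineP; exists u.1.1.
  exists (u - u.1.1 *: 1); last by rewrite addrC subrK.
  by rewrite memv_two_step_nil -[X in X == 0]/(u.1.1 - u.1.1 * 1 : R) mulr1 subrr.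
apply/directv_addP; apply/eqP; rewrite -subv0; apply/subvP => u.
rewrite memv_cap memv0 => /andP[/vlineP[k ->]].
rewrite memv_two_step_nil -[X in X == 0 -> _]/(k * 1 : R) mulr1 => /eqP ->.
by rewrite scale0r.
Qed.

End two_step_weil.

(** * Quaternions *)

Lemma linear_scale (R : realType) (U V : lmodType R) (l : U -> V) : linear l ->
  forall a x, l (a *: x) = a *: l x.
Proof.
move=> ll a x; have := ll a x 0; rewrite !addr0 => ->.
by have := ll (-1) 0 0; rewrite scaler0 addr0 scaleN1r addNr => ->; rewrite addr0.
Qed.

Lemma linear_add (R : realType) (U V : lmodType R) (l : U -> V) : linear l ->
  {morph l : x y / x + y}.
Proof. by move=> ll x y; have := ll 1 x y; rewrite !scale1r. Qed.

Section quaternions.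
Variable R : realType.

Definition quat : vectType R := (R^o * R^o * R^o * R^o)%type.

Definition Quat (a b c d : R) : quat := (a, b, c, d).

Definition qre (x : quat) : R := x.1.1.1.
Definition qi (x : quat) : R := x.1.1.2.
Definition qj (x : quat) : R := x.1.2.
Definition qk (x : quat) : R := x.2.

Definition qmul (x y : quat) : quat := Quat
  (qre x * qre y - qi x * qi y - qj x * qj y - qk x * qk y)
  (qre x * qi y + qi x * qre y + qj x * qk y - qk x * qj y)
  (qre x * qj y - qi x * qk y + qj x * qre y + qk x * qi y)
  (qre x * qk y + qi x * qj y - qj x * qi y + qk x * qre y).

Definition qconj (x : quat) : quat := Quat (qre x) (- qi x) (- qj x) (- qk x).

Definition qdot (x y : quat) : R :=
  qre x * qre y + qi x * qi y + qj x * qj y + qk x * qk y.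

Definition q1 : quat := Quat 1 0 0 0.

Lemma quatP (x y : quat) :
  qre x = qre y -> qi x = qi y -> qj x = qj y -> qk x = qk y -> x = y.
Proof.
by case: x y => [[[a b] c] d] [[[a' b'] c'] d']; rewrite /qre /qi /qj /qk /= =>
  -> -> -> ->.
Qed.

Lemma qreD (x y : quat) : qre (x + y) = qre x + qre y. Proof. by []. Qed.
Lemma qiD (x y : quat) : qi (x + y) = qi x + qi y. Proof. by []. Qed.
Lemma qjD (x y : quat) : qj (x + y) = qj x + qj y. Proof. by []. Qed.
Lemma qkD (x y : quat) : qk (x + y) = qk x + qk y. Proof. by []. Qed.
Lemma qreZ a (x : quat) : qre (a *: x) = a * qre x.
Proof. by case: x => [[[? ?] ?] ?]. Qed.
Lemma qiZ a (x : quat) : qi (a *: x) = a * qi x.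
Proof. by case: x => [[[? ?] ?] ?]. Qed.
Lemma qjZ a (x : quat) : qj (a *: x) = a * qj x.
Proof. by case: x => [[[? ?] ?] ?]. Qed.
Lemma qkZ a (x : quat) : qk (a *: x) = a * qk x.
Proof. by case: x => [[[? ?] ?] ?]. Qed.
Lemma qreE a b c d : qre (Quat a b c d) = a. Proof. by []. Qed.
Lemma qiE a b c d : qi (Quat a b c d) = b. Proof. by []. Qed.
Lemma qjE a b c d : qj (Quat a b c d) = c. Proof. by []. Qed.
Lemma qkE a b c d : qk (Quat a b c d) = d. Proof. by []. Qed.

Lemma qreP : linear (qre : quat -> R^o).
Proof. by move=> a x y; rewrite qreD qreZ. Qed.
Lemma qiP : linear (qi : quat -> R^o).
Proof. by move=> a x y; rewrite qiD qiZ. Qed.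
Lemma qjP : linear (qj : quat -> R^o).
Proof. by move=> a x y; rewrite qjD qjZ. Qed.
Lemma qkP : linear (qk : quat -> R^o).
Proof. by move=> a x y; rewrite qkD qkZ. Qed.
Lemma qreN (x : quat) : qre (- x) = - qre x. Proof. by []. Qed.
Lemma qiN (x : quat) : qi (- x) = - qi x. Proof. by []. Qed.
Lemma qjN (x : quat) : qj (- x) = - qj x. Proof. by []. Qed.
Lemma qkN (x : quat) : qk (- x) = - qk x. Proof. by []. Qed.

Definition qE := (qreN, qiN, qjN, qkN, qreD, qiD, qjD, qkD, qreZ, qiZ, qjZ,
  qkZ, qreE, qiE, qjE, qkE).

Local Ltac qring := apply: quatP; rewrite /qmul /qconj /qdot /q1 ?qE; ring.

Lemma qmulA : associative qmul. Proof. by move=> x y z; qring. Qed.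
Lemma qmul1q : left_id q1 qmul. Proof. by move=> x; qring. Qed.
Lemma qmulq1 : right_id q1 qmul. Proof. by move=> x; qring. Qed.

Lemma qmulDr x : {morph qmul x : y z / y + z}. Proof. by move=> y z; qring. Qed.
Lemma qmulDl x : {morph qmul^~ x : y z / y + z}.
Proof. by move=> y z; qring. Qed.
Lemma qmulZr a x y : qmul x (a *: y) = a *: qmul x y. Proof. by qring. Qed.
Lemma qmulZl a x y : qmul (a *: x) y = a *: qmul x y. Proof. by qring. Qed.
Lemma qmul0q x : qmul 0 x = 0. Proof. by rewrite -(scale0r x) qmulZl !scale0r. Qed.
Lemma qmulq0 x : qmul x 0 = 0. Proof. by rewrite -(scale0r x) qmulZr !scale0r. Qed.

Lemma qdotC x y : qdot x y = qdot y x. Proof. by rewrite /qdot; ring. Qed.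
Lemma qdotP x : linear (qdot x : quat -> R^o).
Proof.
move=> a y z; rewrite -[RHS]/(a * qdot x y + qdot x z : R) /qdot !qE; ring.
Qed.

Lemma qdot_mull p x y : qdot (qmul p x) (qmul p y) = qdot p p * qdot x y.
Proof. by rewrite /qdot /qmul !qE; ring. Qed.

Lemma qdot_mulr p x y : qdot (qmul x p) (qmul y p) = qdot p p * qdot x y.
Proof. by rewrite /qdot /qmul !qE; ring. Qed.

Lemma qdot_conj x : qdot (qconj x) (qconj x) = qdot x x.
Proof. by rewrite /qdot /qconj !qE; ring. Qed.

Lemma qmulqV x : qmul x (qconj x) = qdot x x *: q1. Proof. by qring. Qed.
Lemma qmulVq x : qmul (qconj x) x = qdot x x *: q1. Proof. by qring. Qed.

Lemma qdot11 : qdot q1 q1 = 1. Proof. by rewrite /qdot /q1 !qE; ring. Qed.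

Lemma q1_neq0 : q1 != 0.
Proof.
by apply/eqP => /(congr1 qre) /eqP; rewrite qreE -[qre 0]/(0 : R) oner_eq0.
Qed.

Lemma qdot_eq0 x : (qdot x x == 0) = (x == 0).
Proof.
apply/eqP/eqP => [x0|->]; last by rewrite /qdot !mul0r !addr0.
have [] := (sqr_ge0 (qre x), sqr_ge0 (qi x), sqr_ge0 (qj x), sqr_ge0 (qk x)).
move=> [[a2 b2] c2] d2; move: x0; rewrite /qdot -!expr2 => x0.
apply: quatP; rewrite -[RHS]/(0 : R); apply/eqP; rewrite -sqrf_eq0;
  by apply/eqP; lra.
Qed.

Lemma qmul_eq0 x y : (qmul x y == 0) = (x == 0) || (y == 0).
Proof. by rewrite -!qdot_eq0 qdot_mull mulf_eq0. Qed.


Lemma qmulNr x y : qmul x (- y) = - qmul x y. Proof. by qring. Qed.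
Lemma qmulNl x y : qmul (- x) y = - qmul x y. Proof. by qring. Qed.

Definition qI : quat := Quat 0 1 0 0.
Definition qJ : quat := Quat 0 0 1 0.
Definition qK : quat := Quat 0 0 0 1.

(** The multiplication table carries a left factor [z] so that it rewrites inside products bracketed
    to the left by [qmulA]. *)
Lemma qmulII z : qmul (qmul z qI) qI = - z. Proof. by rewrite /qI; qring. Qed.
Lemma qmulJJ z : qmul (qmul z qJ) qJ = - z. Proof. by rewrite /qJ; qring. Qed.
Lemma qmulKK z : qmul (qmul z qK) qK = - z. Proof. by rewrite /qK; qring. Qed.
Lemma qmulIJ z : qmul (qmul z qI) qJ = qmul z qK.
Proof. by rewrite /qI /qJ /qK; qring. Qed.
Lemma qmulJI z : qmul (qmul z qJ) qI = - qmul z qK.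
Proof. by rewrite /qI /qJ /qK; qring. Qed.
Lemma qmulJK z : qmul (qmul z qJ) qK = qmul z qI.
Proof. by rewrite /qI /qJ /qK; qring. Qed.
Lemma qmulKJ z : qmul (qmul z qK) qJ = - qmul z qI.
Proof. by rewrite /qI /qJ /qK; qring. Qed.
Lemma qmulKI z : qmul (qmul z qK) qI = qmul z qJ.
Proof. by rewrite /qI /qJ /qK; qring. Qed.
Lemma qmulIK z : qmul (qmul z qI) qK = - qmul z qJ.
Proof. by rewrite /qI /qJ /qK; qring. Qed.

Definition qmulE := (qmulII, qmulJJ, qmulKK, qmulIJ, qmulJI, qmulJK, qmulKJ,
  qmulKI, qmulIK, qmulNl, qmulNr, @opprK quat).

Lemma quat_decomp x : x = qre x *: q1 + qi x *: qI + qj x *: qJ + qk x *: qK.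
Proof. by rewrite /qI /qJ /qK; qring. Qed.

(* Skolem-Noether for the quaternions: the average [avg y] of [U e y e^-1] over
   the basis intertwines [U] with the identity, and it is nonzero for some [y]
   in the basis since the sum of the [avg e * e^-1] is 4. *)
Lemma quat_inner (U : quat -> quat) :
  linear U -> {morph U : x y / qmul x y} -> U q1 = q1 ->
  exists2 r, r != 0 & forall x, qmul (U x) r = qmul r x.
Proof.
move=> Ul UM U1; pose I := U qI; pose J := U qJ; pose K := U qK.
have UZ := linear_scale Ul; have UD := linear_add Ul.
have UN x : U (- x) = - U x by rewrite -[- x]scaleN1r UZ scaleN1r.
have II : qmul I I = - q1.
  by rewrite -UM -U1 -UN -[qmul qI qI]qmul1q qmulA qmulII.
have JJ : qmul J J = - q1.
  by rewrite -UM -U1 -UN -[qmul qJ qJ]qmul1q qmulA qmulJJ.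
have IJ : qmul I J = K by rewrite -UM -[qmul qI qJ]qmul1q qmulA qmulIJ qmul1q.
have JK : qmul J K = I by rewrite -UM -[qmul qJ qK]qmul1q qmulA qmulJK qmul1q.
have IK : qmul I K = - J by rewrite -IJ qmulA II qmulNl qmul1q.
have JI : qmul J I = - K by rewrite -JK qmulA JJ qmulNl qmul1q.
(* The minus signs come from e^-1 = - e for the three imaginary units. *)
pose avg y := y - qmul (qmul I y) qI - qmul (qmul J y) qJ - qmul (qmul K y) qK.
have Iavg y : qmul I (avg y) = qmul (avg y) qI.
  rewrite /avg !qmulDr !qmulDl !qmulNr !qmulNl !qmulA II IJ IK !qmulNl qmul1q.
  rewrite !qmulE.
  by apply: quatP; rewrite !qE; ring.
have Javg y : qmul J (avg y) = qmul (avg y) qJ.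
  rewrite /avg !qmulDr !qmulDl !qmulNr !qmulNl !qmulA JI JJ JK !qmulNl qmul1q.
  rewrite !qmulE.
  by apply: quatP; rewrite !qE; ring.
have Kavg y : qmul K (avg y) = qmul (avg y) qK.
  rewrite -IJ -qmulA Javg qmulA Iavg -qmulA; congr qmul.
  by rewrite -[qmul qI qJ]qmul1q qmulA qmulIJ qmul1q.
have sum_avg : avg q1 - qmul (avg qI) qI - qmul (avg qJ) qJ - qmul (avg qK) qK =
    4 *: q1.
  have sq : [/\ qmul qI qI = - q1, qmul qJ qJ = - q1 & qmul qK qK = - q1].
    by split; rewrite -[LHS]qmul1q qmulA qmulE.
  case: sq => sI sJ sK; rewrite /avg !qmulDl !qmulNl sI sJ sK !qmulq1 !qmulE.
  (* Each of these three products occurs twice with each sign and cancels; what is left is four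
     times 1. *)
  move: (qmul I qI) (qmul J qJ) (qmul K qK) => a b c.
  by apply: quatP; rewrite !qE; ring.
have [y y0] : exists y, avg y != 0.
  apply/not_existsP => av0; have {}av0 y : avg y = 0.
    by apply/eqP/negPn/negP; exact: av0.
  have /eqP := sum_avg; rewrite !av0 !qmul0q !subr0 eq_sym scaler_eq0.
  by rewrite (negPf q1_neq0) pnatr_eq0.
move: (avg y) y0 (Iavg y) (Javg y) (Kavg y) => r r0 Ir Jr Kr.
exists r => // x; rewrite {1}[x]quat_decomp [in RHS](quat_decomp x).
rewrite !UD !UZ !qmulDl !qmulDr !qmulZl !qmulZr -/I -/J -/K U1 qmul1q qmulq1.
by rewrite Ir Jr Kr.
Qed.

End quaternions.

(** * Curves of automorphisms *)

Section weakly_continuous.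
Variable R : realType.

(* Continuity of a curve in a finite-dimensional space, which carries no
   topology here, is expressed through its linear coordinates. *)
Definition wcont (U : lmodType R) (g : R -> U) :=
  forall l : U -> R^o, linear l -> continuous (fun t => l (g t) : R).

Lemma wcont_real (g : R -> R) : continuous g -> wcont (g : R -> R^o).
Proof.
move=> gc l ll.
have -> : (fun t => l (g t) : R) = (fun t => g t * (l 1 : R)).
  by apply/funext => t; rewrite -[g t in LHS]mulr1 (linear_scale ll).
by apply: continuous_mulr => //; exact: cst_continuous.
Qed.

(** A linear form on a product is the sum of its restrictions to the two factors. *)
Lemma wcont_pair (U V : lmodType R) (f : R -> U) (g : R -> V) :
  wcont f -> wcont g -> wcont (fun t => (f t, g t)).
Proof.
move=> fc gc l ll.
have -> : (fun t => l (f t, g t) : R) =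
          (fun t => (l (f t, 0) : R) + (l (0, g t) : R)).
  by apply/funext => t; rewrite -(linear_add ll); congr l;
    congr pair; rewrite /= ?addr0 ?add0r.
apply: continuous_addr.
  apply: (fc (fun u => l (u, 0))) => a u v; rewrite -ll; congr l.
  by congr pair; rewrite /= scaler0 addr0.
apply: (gc (fun v => l (0, v))) => a u v; rewrite -ll; congr l.
by congr pair; rewrite /= scaler0 addr0.
Qed.

Lemma wcont_cst (U : lmodType R) (u : U) : wcont (fun=> u).
Proof. by move=> l _; exact: cst_continuous. Qed.

Lemma wcontD (U : lmodType R) (f g : R -> U) :
  wcont f -> wcont g -> wcont (fun t => f t + g t).
Proof.
move=> fc gc l ll.
have -> : (fun t => l (f t + g t) : R) = (fun t => (l (f t) : R) + (l (g t) : R)).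
  by apply/funext => t; rewrite (linear_add ll).
by apply: continuous_addr; [exact: fc | exact: gc].
Qed.

Lemma wcontZ (U : lmodType R) (c : R -> R) (f : R -> U) :
  continuous c -> wcont f -> wcont (fun t => c t *: f t).
Proof.
move=> cc fc l ll.
have -> : (fun t => l (c t *: f t) : R) = (fun t => c t * (l (f t) : R)).
  by apply/funext => t; rewrite (linear_scale ll).
by apply: continuous_mulr => //; exact: fc.
Qed.

Lemma wcont_Quat (a b c d : R -> R) :
  continuous a -> continuous b -> continuous c -> continuous d ->
  wcont (fun t => Quat (a t) (b t) (c t) (d t)).
Proof. by move=> *; do ?apply: wcont_pair; apply: wcont_real. Qed.

Lemma wcont_qcoord (g : R -> quat R) : wcont g ->
  [/\ continuous (fun t => qre (g t)), continuous (fun t => qi (g t)),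
      continuous (fun t => qj (g t)) & continuous (fun t => qk (g t))].
Proof.
move=> gc.
by split; apply: gc; [exact: qreP | exact: qiP | exact: qjP | exact: qkP].
Qed.

Lemma wcont_qmul (f g : R -> quat R) :
  wcont f -> wcont g -> wcont (fun t => qmul (f t) (g t)).
Proof.
move=> /wcont_qcoord[a b c d] /wcont_qcoord[a' b' c' d'].
apply: wcont_Quat; do 4?[apply: continuous_addr | apply: continuous_oppr];
  exact: continuous_mulr.
Qed.

Lemma wcont_qconj (f : R -> quat R) : wcont f -> wcont (fun t => qconj (f t)).
Proof.
move=> /wcont_qcoord[a b c d].
by apply: wcont_Quat => //; apply: continuous_oppr.
Qed.

Lemma wcont_qdot (f g : R -> quat R) :
  wcont f -> wcont g -> continuous (fun t => qdot (f t) (g t)).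
Proof.
move=> /wcont_qcoord[a b c d] /wcont_qcoord[a' b' c' d'].
by do ?apply: continuous_addr; apply: continuous_mulr.
Qed.

End weakly_continuous.

(** * Connectedness of the automorphism group through paths *)

Section aut_component.
Variables (R : realType) (A : falgType R).

Definition aut_joined (f g : 'End(A)) :=
  connected_component ((@lfun_mx R A) @` (@alg_aut R A)) (lfun_mx f) (lfun_mx g).

Lemma aut_joined_trans g f h : aut_joined f g -> aut_joined g h -> aut_joined f h.
Proof. exact: connected_component_trans. Qed.

Lemma aut_joined_path (phi : R -> 'End(A)) :
  (forall t, 0 <= t <= 1 -> alg_aut (phi t)) ->
  (forall u, wcont (fun t => phi t u)) -> aut_joined (phi 0) (phi 1).
Proof.
move=> phia phic; pose C := (fun t => lfun_mx (phi t)) @` `[0, 1]%classic.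
exists C; last by exists 1; rewrite //= in_itv /= ler01 lexx.
split; first by exists 0; rewrite //= in_itv /= ler01 lexx.
  move=> _ [t /= t01 <-]; exists (phi t) => //; apply: phia.
  by move: t01; rewrite in_itv.
apply: connected_continuous_connected; first exact: segment_connected.
apply: continuous_subspaceT; apply: continuous_mx => i j.
have -> : (fun t => lfun_mx (phi t) i j) =
    (fun t => coord (vbasis {:A}) j (phi t (vbasis {:A})`_i)).
  by apply/funext => t; rewrite lfun_mx_coord.
by apply: phic => a u v; rewrite linearP.
Qed.

Lemma aut_joined_connected (f : 'End(A)) :
  (forall g, alg_aut g -> aut_joined g f) -> connected_aut A.
Proof.
move=> joined; rewrite /connected_aut; set S := image _ _.
suff <- : connected_component S (lfun_mx f) = S by exact: component_connected.
apply/seteqP; split; first exact: connected_component_sub.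
by move=> _ [g ga <-]; apply: connected_component_sym; exact: joined.
Qed.

End aut_component.

(** * The algebra R itself, obtained from V = W = 0 *)

Section trivial_example.
Variable R : realType.

Definition zero_bil_fun (u v : 'rV[R]_0) : 'rV[R]_0 := 0.

Fact zero_bilC u v : zero_bil_fun u v = zero_bil_fun v u.
Proof. by []. Qed.

Fact zero_bilP u : linear (zero_bil_fun u).
Proof. by move=> a v w; rewrite scaler0 addr0. Qed.

Definition zero_bil : symbil 'rV[R]_0 'rV[R]_0 := SymBil zero_bilC zero_bilP.

Lemma zero_bil_aut (f : 'End(two_step zero_bil)) : alg_aut f -> f = \1%VF.
Proof.
move=> fa; apply/lfunP => u; rewrite id_lfunE.
have -> : u = u.1.1 *: 1.
  case: u => [[a v] w]; congr (_, _, _); last 2 first.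
  - by rewrite /= [v]thinmx0 [RHS]thinmx0.
  - by rewrite /= [w]thinmx0 [RHS]thinmx0.
  by rewrite -[RHS]/(a * 1 : R) mulr1.
by rewrite linearZ /= (alg_aut_one fa).
Qed.

Lemma zero_bil_connected : connected_aut (two_step zero_bil).
Proof.
rewrite /connected_aut.
suff -> : @alg_aut R (two_step zero_bil) = [set \1%VF].
  by rewrite image_set1; exact: connected1.
apply/seteqP; split=> [f /zero_bil_aut //|f ->]; exact: alg_aut1.
Qed.

End trivial_example.

(** * The quaternionic example *)

Section quaternionic_example.
Variable R : realType.
Local Notation H := (quat R).

(* The generators are pairs (x, y); the target is R e + Z. *)
Definition qbil_fun (u v : (H * H)%type) : (R^o * H)%type :=
  (qdot u.1 v.1 : R^o, qmul u.1 v.2 + qmul v.1 u.2).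

Fact qbilC u v : qbil_fun u v = qbil_fun v u.
Proof. by rewrite /qbil_fun qdotC addrC. Qed.

Fact qbilP u : linear (qbil_fun u).
Proof.
move=> a v w; congr pair; first exact: (qdotP u.1 a v.1 w.1).
rewrite /= !qmulDr !qmulDl !qmulZr qmulZl scalerDr -!addrA; congr (_ + _).
by rewrite addrCA.
Qed.

Definition qbil : symbil (H * H)%type (R^o * H)%type := SymBil qbilC qbilP.
Local Notation T := (two_step qbil).

Definition qelt (a : R) (x y : H) (e : R) (z : H) : T := (a, (x, y), (e, z)).

Lemma qelt_mul a x y e z a' x' y' e' z' :
  qelt a x y e z * qelt a' x' y' e' z' =
  qelt (a * a') (a *: x' + a' *: x) (a *: y' + a' *: y)
       (a * e' + a' * e + qdot x x')
       (a *: z' + a' *: z + (qmul x y' + qmul x' y)).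
Proof. by []. Qed.

Lemma qeltD a x y e z a' x' y' e' z' :
  qelt a x y e z + qelt a' x' y' e' z' =
  qelt (a + a') (x + x') (y + y') (e + e') (z + z').
Proof. by []. Qed.

Lemma qeltZ c a x y e z :
  c *: qelt a x y e z = qelt (c * a) (c *: x) (c *: y) (c * e) (c *: z).
Proof. by []. Qed.

Lemma qelt_eta (u : T) : u = qelt u.1.1 u.1.2.1 u.1.2.2 u.2.1 u.2.2.
Proof. by case: u => [[a [x y]] [e z]]. Qed.

Lemma qelt_eq0 a x y e z :
  qelt a x y e z = 0 -> [/\ a = 0, x = 0, y = 0, e = 0 & z = 0].
Proof.
move=> u0; split; [exact: (congr1 (fun u : T => u.1.1) u0)
  | exact: (congr1 (fun u : T => u.1.2.1) u0)
  | exact: (congr1 (fun u : T => u.1.2.2) u0)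
  | exact: (congr1 (fun u : T => u.2.1) u0)
  | exact: (congr1 (fun u : T => u.2.2) u0)].
Qed.

(** Conjugation by [r] followed by right multiplication by [s], up to a positive scalar when [r] is
    nonzero. Using the conjugate of [r] in place of its inverse keeps the expression polynomial in
    the parameters. *)
Definition sandwich (r s x : H) := qmul (qmul (qmul r x) (qconj r)) s.

Fact sandwichP r s : linear (sandwich r s).
Proof. by move=> a x y; rewrite /sandwich !(qmulDr, qmulZr, qmulDl, qmulZl). Qed.

Lemma qdot_sandwich r s x y :
  qdot (sandwich r s x) (sandwich r s y) = qdot r r ^+ 2 * qdot s s * qdot x y.
Proof. by rewrite !qdot_mulr qdot_mull qdot_conj; ring. Qed.

Lemma sandwich_eq0 r s x : r != 0 -> s != 0 -> sandwich r s x = 0 -> x = 0.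
Proof.
move=> r0 s0 /eqP; rewrite -qdot_eq0 qdot_sandwich !mulf_eq0.
by rewrite !qdot_eq0 (negPf r0) (negPf s0) => /eqP.
Qed.

Definition qscale (p r : H) : R := qdot p p * qdot r r.

(** The action on X and Y determines the rest: multiplicativity forces the factor |r|^4 |p|^2 on e
    (see [qdot_sandwich]) and the map on Z given by [sandwich_mul]. *)
Definition diag_fun (p r s : H) (u : T) : T :=
  qelt u.1.1 (sandwich r p u.1.2.1) (qmul (qconj p) (sandwich r s u.1.2.2))
       (qdot r r * qscale p r * u.2.1) (qscale p r *: sandwich r s u.2.2).

Fact diag_linear p r s : linear (diag_fun p r s).
Proof.
move=> a u v; rewrite /diag_fun qeltZ qeltD.
congr (_, (_, _), (_, _)); rewrite /= ?sandwichP ?qmulDr ?qmulZr //.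
  by rewrite mulrDr mulrCA.
by rewrite scalerDr !scalerA mulrC.
Qed.

HB.instance Definition _ p r s :=
  GRing.isLinear.Build R T T _ (diag_fun p r s) (diag_linear p r s).

Definition diag_end p r s : 'End(T) := linfun (diag_fun p r s).

Lemma diag_endE p r s u : diag_end p r s u = diag_fun p r s u.
Proof. by rewrite lfunE. Qed.

(** The inner factor r^* p p^* r between [x] and [y] collapses to the scalar [qscale p r]. *)
Lemma sandwich_mul p r s x y :
  qmul (sandwich r p x) (qmul (qconj p) (sandwich r s y)) =
  qscale p r *: sandwich r s (qmul x y).
Proof.
rewrite /sandwich /qscale.
have -> : qmul (qmul (qmul (qmul r x) (qconj r)) p)
               (qmul (qconj p) (qmul (qmul (qmul r y) (qconj r)) s)) =
  qmul (qmul (qmul (qmul (qmul r x)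
    (qmul (qconj r) (qmul (qmul p (qconj p)) r))) y) (qconj r)) s.
  by rewrite !qmulA.
rewrite qmulqV qmulZl qmul1q qmulZr qmulVq scalerA qmulZr qmulq1.
by rewrite !qmulZl !qmulA.
Qed.

Lemma diag_mul p r s : {morph diag_end p r s : u v / u * v}.
Proof.
move=> u v; rewrite !diag_endE {1}[u]qelt_eta {1}[v]qelt_eta qelt_mul.
rewrite /diag_fun qelt_mul.
move: u.1.1 u.1.2.1 u.1.2.2 u.2.1 u.2.2 v.1.1 v.1.2.1 v.1.2.2 v.2.1 v.2.2.
move=> a x y e z a' x' y' e' z' /=.
have sD := linear_add (sandwichP r _); have sZ := linear_scale (sandwichP r _).
congr (_, (_, _), (_, _)).
- by rewrite sD !sZ.
- by rewrite sD !sZ qmulDr !qmulZr.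
- by rewrite qdot_sandwich /qscale; ring.
rewrite !sandwich_mul 3!sD !scalerDr !sZ !scalerA.
by rewrite [_ * a]mulrC [_ * a']mulrC.
Qed.

Lemma diag_aut p r s : p != 0 -> r != 0 -> s != 0 -> alg_aut (diag_end p r s).
Proof.
move=> p0 r0 s0; have pr0 : qscale p r != 0 by rewrite mulf_neq0 ?qdot_eq0.
apply: alg_aut_inj; first exact: diag_mul.
  rewrite diag_endE; congr (_, (_, _), (_, _));
    rewrite /sandwich /= ?qmulq0 ?qmul0q ?qmulq0 ?mulr0 ?scaler0 //.
apply/lker0P; rewrite -subv0; apply/subvP => u; rewrite memv_ker memv0 diag_endE.
rewrite [u]qelt_eta; move: u.1.1 u.1.2.1 u.1.2.2 u.2.1 u.2.2 => a x y e z.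
move=> /eqP/qelt_eq0 /= [-> /(sandwich_eq0 r0 p0)-> /eqP + /eqP + /eqP].
rewrite qmul_eq0 -qdot_eq0 qdot_conj qdot_eq0 (negPf p0) /= => /eqP.
move=> /(sandwich_eq0 r0 s0)->.
rewrite !mulf_eq0 !qdot_eq0 (negPf p0) (negPf r0) /= => /eqP->.
by rewrite scaler_eq0 (negPf pr0) /= => /eqP/(sandwich_eq0 r0 s0)->.
Qed.


(** * Paths of nonzero quaternions and of block-diagonal automorphisms *)

Definition qseg (p q : H) (t : R) : H := (1 - t) *: p + t *: q.

Lemma qseg0 p q : qseg p q 0 = p.
Proof. by rewrite /qseg subr0 scale1r scale0r addr0. Qed.

Lemma qseg1 p q : qseg p q 1 = q.
Proof. by rewrite /qseg subrr scale0r scale1r add0r. Qed.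

Lemma qseg_one_neq0 p t : p != qre p *: q1 R -> qseg p (q1 R) t != 0.
Proof.
apply: contra_neq => /eqP; rewrite /qseg addr_eq0 => /eqP pt.
have t1 : 1 - t != 0.
  apply/eqP => t1; move: pt; rewrite t1 scale0r => /esym/eqP.
  rewrite oppr_eq0 scaler_eq0 (negPf (q1_neq0 R)) orbF => /eqP t0.
  by move: t1 => /eqP; rewrite t0 subr0 oner_eq0.
have pE : p = ((1 - t)^-1 * - t) *: q1 R.
  by rewrite -scalerA scaleNr -pt scalerA mulVf // scale1r.
by rewrite pE qreZ qreE mulr1.
Qed.

Lemma qseg_i_neq0 p t : p != 0 -> p = qre p *: q1 R -> qseg p (qI R) t != 0.
Proof.
move=> p0 pE; apply/eqP => pt.
have ip : qi p = 0 by rewrite pE qiZ qiE mulr0.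
have t0 : t = 0.
  have : qi (qseg p (qI R) t) = 0 by rewrite pt.
  by rewrite qiD !qiZ ip qiE mulr0 add0r mulr1.
by move: pt; rewrite t0 qseg0 => /eqP; rewrite (negPf p0).
Qed.

Lemma wcont_qseg p q : wcont (qseg p q).
Proof.
have idc : continuous (id : R -> R) by move=> x; exact: cvg_id.
apply: wcontD; apply: wcontZ => //; try exact: wcont_cst.
apply: continuous_addr; first exact: cst_continuous.
exact: continuous_oppr.
Qed.

(** The segment from [p] to 1 avoids 0 unless [p] is real. A nonzero real [p] is first joined to i,
    which is then joined to 1. *)
Lemma quat_joined (G : H -> 'End(T)) :
  (forall p, p != 0 -> alg_aut (G p)) ->
  (forall u g, wcont g -> wcont (fun t => G (g t) u)) ->
  forall p, p != 0 -> aut_joined (G p) (G (q1 R)).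
Proof.
move=> Ga Gc.
have seg p q : (forall t, qseg p q t != 0) -> aut_joined (G p) (G q).
  move=> pq; rewrite -[p in G p](qseg0 p q) -[q in aut_joined _ (G q)](qseg1 p q).
  apply: (@aut_joined_path _ _ (fun t => G (qseg p q t))) => [t _|u].
    exact: Ga.
  by apply: Gc; exact: wcont_qseg.
move=> p p0; have [pE|pE] := eqVneq p (qre p *: q1 R); last first.
  by apply: seg => t; exact: qseg_one_neq0.
apply: (@aut_joined_trans _ _ (G (qI R))).
  by apply: seg => t; exact: qseg_i_neq0.
apply: seg => t; apply: qseg_one_neq0; apply/eqP => /(congr1 (@qi R)) /eqP.
by rewrite qiZ !qiE mulr0 oner_eq0.
Qed.

Lemma wcont_diag (p r s : R -> H) u : wcont p -> wcont r -> wcont s ->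
  wcont (fun t => diag_end (p t) (r t) (s t) u).
Proof.
move=> pc rc sc.
have -> : (fun t => diag_end (p t) (r t) (s t) u) =
          (fun t => diag_fun (p t) (r t) (s t) u).
  by apply/funext => t; rewrite diag_endE.
have sandc g x : wcont g -> wcont (fun t => sandwich (r t) (g t) x).
  move=> gc; apply: wcont_qmul => //; apply: wcont_qmul; last exact: wcont_qconj.
  by apply: wcont_qmul => //; exact: wcont_cst.
have scalec : continuous (fun t => qscale (p t) (r t)).
  by apply: continuous_mulr; exact: wcont_qdot.
apply: (@wcont_pair R (R^o * (H * H))%type (R^o * H)%type).
  apply: wcont_pair; first exact: wcont_cst.
  apply: wcont_pair; first exact: sandc.
  by apply: wcont_qmul; [exact: wcont_qconj | exact: sandc].
apply: wcont_pair; last by apply: wcontZ => //; exact: sandc.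
apply: wcont_real; apply: continuous_mulr; last exact: cst_continuous.
by apply: continuous_mulr => //; exact: wcont_qdot.
Qed.

Lemma diag_joined p r s : p != 0 -> r != 0 -> s != 0 ->
  aut_joined (diag_end p r s) (diag_end (q1 R) (q1 R) (q1 R)).
Proof.
move=> p0 r0 s0; have q10 := q1_neq0 R.
apply: (@aut_joined_trans _ _ (diag_end (q1 R) r s)).
  apply: (@quat_joined (fun p => diag_end p r s)) => // [x x0|u g gc].
    exact: diag_aut.
  by apply: wcont_diag => //; exact: wcont_cst.
apply: (@aut_joined_trans _ _ (diag_end (q1 R) (q1 R) s)).
  apply: (@quat_joined (fun r => diag_end _ r s)) => // [x x0|u g gc].
    exact: diag_aut.
  by apply: wcont_diag => //; exact: wcont_cst.
apply: (@quat_joined (fun s => diag_end _ _ s)) => // [x x0|u g gc].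
  exact: diag_aut.
by apply: wcont_diag => //; exact: wcont_cst.
Qed.

End quaternionic_example.

(** * The shape of an arbitrary automorphism *)

Section quaternionic_automorphism.
Variable R : realType.
Local Notation H := (quat R).
Local Notation T := (two_step (qbil R)).
Local Notation qX x := (@qelt R 0 x 0 0 0).
Local Notation qY y := (@qelt R 0 0 y 0 0).
Local Notation qEl e := (@qelt R 0 0 0 e 0).
Local Notation qZ z := (@qelt R 0 0 0 0 z).

Lemma qdot0 (x : H) : qdot x 0 = 0.
Proof. by rewrite /qdot !mulr0 !addr0. Qed.

Lemma qelt_mul0 (x y : H) e z x' y' e' z' :
  qelt 0 x y e z * qelt 0 x' y' e' z' =
  qelt 0 0 0 (qdot x x') (qmul x y' + qmul x' y).
Proof. by rewrite qelt_mul !mul0r !scale0r !add0r. Qed.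

Variable f : 'End(T).
Hypothesis fa : alg_aut f.

Definition autP (x : H) : H := (f (qX x)).1.2.1.
Definition autS (x : H) : H := (f (qX x)).1.2.2.
Definition autQ (y : H) : H := (f (qY y)).1.2.2.

Lemma aut_nil (u : T) : u.1.1 = 0 -> (f u).1.1 = 0.
Proof.
move=> /two_step_cube u3; apply/eqP; rewrite -(@memv_two_step_nil R _ _ (qbil R)).
apply/two_step_nilP; exists 3%N.
by rewrite !exprS expr0 mulr1 -!(alg_autM fa) -expr2 -exprS u3 linear0.
Qed.

Lemma aut_X x : f (qX x) = qelt 0 (autP x) (autS x) (f (qX x)).2.1 (f (qX x)).2.2.
Proof. by rewrite {1}[f _]qelt_eta aut_nil. Qed.

(* The image squares to zero and the form on X is definite. *)
Lemma aut_Y y : f (qY y) = qelt 0 0 (autQ y) (f (qY y)).2.1 (f (qY y)).2.2.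
Proof.
rewrite {1}[f _]qelt_eta aut_nil //; congr (_, (_, _), _).
have : f (qY y) * f (qY y) = 0.
  by rewrite -(alg_autM fa) qelt_mul0 qdot0 qmul0q addr0 linear0.
rewrite [f (qY y)]qelt_eta aut_nil // qelt_mul0 => /qelt_eq0[_ _ _ /eqP + _].
by rewrite qdot_eq0 => /eqP.
Qed.

Lemma aut_Z x y : f (qZ (qmul x y)) = qZ (qmul (autP x) (autQ y)).
Proof.
have -> : qZ (qmul x y) = qX x * qY y :> T.
  by rewrite qelt_mul0 qdot0 qmul0q addr0.
by rewrite (alg_autM fa) aut_X aut_Y qelt_mul0 qdot0 qmul0q addr0.
Qed.

Lemma aut_E e : exists z, f (qEl e) = qelt 0 0 0 (qdot (autP (q1 R)) (autP (q1 R)) * e) z.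
Proof.
have -> : qEl e = e *: (qX (q1 R) * qX (q1 R)) :> T.
  by rewrite qelt_mul0 qdot11 qmulq0 addr0 qeltZ !mulr0 !scaler0 mulr1.
rewrite linearZ /= (alg_autM fa) aut_X qelt_mul0 qeltZ mulr0 !scaler0 mulrC.
by eexists.
Qed.

Fact autP_linear : linear autP.
Proof.
move=> a x y; rewrite /autP.
have -> : qX (a *: x + y) = a *: qX x + qX y :> T.
  by rewrite qeltZ qeltD !mulr0 !scaler0 !addr0.
by rewrite linearP.
Qed.

Lemma qmulIr (q x y : H) : q != 0 -> qmul x q = qmul y q -> x = y.
Proof.
move=> q0 xy; apply/eqP; rewrite -subr_eq0; apply/eqP.
have : qmul (x - y) q == 0 by rewrite qmulDl qmulNl xy subrr.
by rewrite qmul_eq0 (negPf q0) orbF => /eqP.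
Qed.

(** Their product is the image of the unit of Z, which the injective [f] cannot kill. *)
Lemma autP1_autQ1 : autP (q1 R) != 0 /\ autQ (q1 R) != 0.
Proof.
have : qmul (autP (q1 R)) (autQ (q1 R)) != 0.
  apply/eqP => pq0; have := aut_Z (q1 R) (q1 R); rewrite pq0 qmul1q => fZ.
  have fI : injective f by apply/lker0P; exact: alg_aut_lker.
  have /fI/qelt_eq0[_ _ _ _ /eqP] : f (qZ (q1 R)) = f 0 by rewrite linear0 fZ.
  by rewrite (negPf (q1_neq0 R)).
by rewrite qmul_eq0 negb_or => /andP[].
Qed.

(** The pairs (x, y) and (1, xy) have the same product in Z; comparing images eliminates the action
    of [f] on Z. *)
Lemma aut_autotopy x y :
  qmul (autP x) (autQ y) = qmul (autP (q1 R)) (autQ (qmul x y)).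
Proof.
have := aut_Z (q1 R) (qmul x y); rewrite qmul1q aut_Z.
by move=> /(congr1 (fun u : T => u.2.2)).
Qed.

(* The normalised map [U] is an automorphism of the quaternions. *)
Lemma aut_quat : exists p r s, [/\ p != 0, r != 0, s != 0,
  autP =1 sandwich r p & forall y, autQ y = qmul (qconj p) (sandwich r s y)].
Proof.
have [] := autP1_autQ1; set p0 := autP _; set q0 := autQ _ => p00 q00.
have n0 : qdot p0 p0 != 0 by rewrite qdot_eq0.
have Q_P y : qdot p0 p0 *: autQ y = qmul (qconj p0) (qmul (autP y) q0).
  by rewrite [qmul (autP y) q0]aut_autotopy qmulq1 qmulA qmulVq qmulZl qmul1q.
(* After right multiplication by [q0], both sides equal |p0|^2 P(x) Q(y). This says that U(x) = P(x)
   p0^-1 is multiplicative. *)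
have PP x y : qmul (qmul (autP x) (qconj p0)) (autP y) =
    qdot p0 p0 *: autP (qmul x y).
  apply: (qmulIr q00); rewrite -!qmulA -Q_P qmulZr qmulZl; congr (_ *: _).
  by rewrite aut_autotopy [in RHS]aut_autotopy qmulq1.
pose U x := (qdot p0 p0)^-1 *: qmul (autP x) (qconj p0).
have UP x : qmul (U x) p0 = autP x.
  by rewrite qmulZl -qmulA qmulVq qmulZr qmulq1 scalerA mulVf // scale1r.
have [] := @quat_inner R U.
- by move=> a x y; rewrite /U autP_linear qmulDl qmulZl scalerDr !scalerA mulrC.
- by move=> x y; rewrite /U qmulZl qmulZr !qmulA PP qmulZl !scalerA mulfVK.
- by rewrite /U -/p0 qmulqV scalerA mulVf // scale1r.
move=> r r0 Ur; have m0 : qdot r r != 0 by rewrite qdot_eq0.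
(* From U(x) r = r x follows P(x) = |r|^-2 r x r^* p0; the scalar is absorbed into [p]. *)
have [p p0E] : exists p, p0 = qdot r r *: p.
  by exists ((qdot r r)^-1 *: p0); rewrite scalerA mulfV // scale1r.
have p_neq0 : p != 0 by apply: contra_neq p00 => p_0; rewrite p0E p_0 scaler0.
have PE x : autP x = sandwich r p x.
  rewrite -UP /sandwich -Ur -[qmul (qmul (U x) r) _]qmulA qmulqV p0E.
  by rewrite !qmulZr qmulq1 qmulZl.
have conjZ a x : qconj (a *: x) = a *: qconj x :> H.
  by apply: quatP; rewrite /qconj !qE ?mulrN.
(* Solved from Q(y) = |p0|^-2 p0^* P(y) q0, with p0^* = |r|^2 p^* and P(y) = r y r^* p. *)
pose s := ((qdot p0 p0)^-1 * qdot r r) *: qmul p q0.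
exists p, r, s; split; [exact: p_neq0 | exact: r0 | | exact: PE |].
  rewrite /s scaler_eq0 negb_or qmul_eq0 negb_or p_neq0 q00 andbT.
  by rewrite mulf_neq0 ?invr_eq0.
move=> y; apply: (scalerI n0); rewrite Q_P PE {1}p0E conjZ.
rewrite /sandwich /s !qmulZl !qmulZr scalerA mulrA mulfV // mul1r; congr (_ *: _).
by rewrite !qmulA.
Qed.

(** In the order X, Y, e, Z the deviation from the block-diagonal part is strictly triangular: each
    component depends on earlier coordinates only. Its vanishing at 0 allows the coordinates of a
    kernel element to be eliminated one after another. *)
Lemma aut_form : exists p r s, [/\ p != 0, r != 0 & s != 0] /\
  exists (S : H -> H) (al : H -> H -> R) (ze : H -> H -> R -> H),
  [/\ S 0 = 0, al 0 0 = 0, ze 0 0 0 = 0 &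
   forall a x y e z, f (qelt a x y e z) =
     diag_fun p r s (qelt a x y e z) + qelt 0 0 (S x) (al x y) (ze x y e)].
Proof.
have [p [r [s [p0 r0 s0 PE QE]]]] := aut_quat.
exists p, r, s; split => //; exists autS.
exists (fun x y => (f (qX x)).2.1 + (f (qY y)).2.1).
exists (fun x y e => (f (qX x)).2.2 + (f (qY y)).2.2 + (f (qEl e)).2.2).
have f0 : f (qelt 0 0 0 0 0) = 0 by rewrite linear0.
split; rewrite /autS ?f0 ?addr0 // => a x y e z.
have uE : qelt a x y e z = a *: (1 : T) + qX x + qY y + qEl e + qZ z.
  by rewrite -[1]/(@qelt R 1 0 0 0 0) qeltZ !qeltD !scaler0 !mulr0 mulr1 !(addr0, add0r).
rewrite [in LHS]uE !linearD linearZ /= (alg_aut_one fa) {1}[f (qX x)]aut_X {1}[f (qY y)]aut_Y.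
have [z' fE] := aut_E e; rewrite fE.
have -> : f (qZ z) = qZ (qscale p r *: sandwich r s z).
  by rewrite -[z in LHS]qmul1q aut_Z PE QE sandwich_mul qmul1q.
rewrite /autS /diag_fun -[1]/(@qelt R 1 0 0 0 0) qeltZ !qeltD /=.
rewrite !scaler0 !mulr0 mulr1 !(addr0, add0r).
congr (_, (_, _), (_, _)).
- exact: PE.
- by rewrite QE addrC.
- rewrite PE qdot_sandwich qdot11 mulr1 /qscale addrC; congr (_ + _); ring.
- by rewrite addrC.
Qed.

End quaternionic_automorphism.

(** * Connectedness, and a value of [D1] other than 1 *)

Section quaternionic_connected.
Variable R : realType.
Local Notation H := (quat R).
Local Notation T := (two_step (qbil R)).

Lemma aut_joined_diag (f : 'End(T)) : alg_aut f ->
  exists p r s, [/\ p != 0, r != 0, s != 0 & aut_joined (diag_end p r s) f].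
Proof.
move=> fa; have [p [r [s [[p0 r0 s0] [S [al [ze [S0 al0 ze0 fE]]]]]]]] := aut_form fa.
exists p, r, s; split=> //; set F := diag_end p r s; pose D := f - F.
have DE a x y e z : D (qelt a x y e z) = qelt 0 0 (S x) (al x y) (ze x y e).
  by rewrite /D add_lfunE opp_lfunE fE diag_endE addrAC subrr add0r.
have fFD u : f u = F u + D u by rewrite /D add_lfunE opp_lfunE addrC subrK.
(* The values of [D] lie in Y + R e + Z, where all products vanish. *)
have DD u v : D u * D v = 0.
  by rewrite [u]qelt_eta [v]qelt_eta !DE qelt_mul0 qdot0 !qmul0q addr0.
have FM : {morph F : u v / u * v} := alg_autM (diag_aut p0 r0 s0).
(* Thus [D] is a derivation along [F]; as the quadratic term in t vanishes, F + t D is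
   multiplicative for every t. *)
have DM u v : D (u * v) = F u * D v + D u * F v.
  apply: (addrI (F (u * v))); rewrite -fFD (alg_autM fa) !fFD mulrDl !mulrDr.
  by rewrite DD addr0 FM addrA.
have phiE t u : (F + t *: D) u = F u + t *: D u by rewrite add_lfunE scale_lfunE.
have phi0 : F = F + 0 *: D by rewrite scale0r addr0.
have phi1 : f = F + 1 *: D by rewrite scale1r /D addrC subrK.
rewrite [X in aut_joined X]phi0 [X in aut_joined _ X]phi1.
apply: (@aut_joined_path _ _ (fun t => F + t *: D)) => [t _|u]; last first.
  have -> : (fun t => (F + t *: D) u) = (fun t => F u + t *: D u).
    by apply/funext => t; rewrite phiE.
  apply: wcontD; first exact: wcont_cst.
  by apply: wcontZ; [move=> x; exact: cvg_id | exact: wcont_cst].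
apply: alg_aut_inj => [u v||].
- rewrite !phiE FM DM mulrDl !mulrDr -!scalerAl -!scalerAr DD !scaler0 addr0.
  by rewrite scalerDr addrA.
- rewrite phiE (alg_aut_one (diag_aut p0 r0 s0)) -[1]/(@qelt R 1 0 0 0 0) DE.
  by rewrite S0 al0 ze0 qeltZ !mulr0 !scaler0 qeltD !addr0.
apply/lker0P; rewrite -subv0; apply/subvP => u; rewrite memv_ker memv0 phiE.
rewrite [u]qelt_eta; move: u.1.1 u.1.2.1 u.1.2.2 u.2.1 u.2.2 => a x y e z.
rewrite DE qeltZ diag_endE /diag_fun qeltD !mulr0 !scaler0 !addr0 /=.
have n0 : qdot r r * qscale p r != 0 by rewrite !mulf_neq0 ?qdot_eq0.
have m0 : qscale p r != 0 by rewrite !mulf_neq0 ?qdot_eq0.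
(* Triangular elimination: once the earlier coordinates are 0, the perturbation in the next
   component disappears and the injective diagonal block remains. *)
move=> /eqP/qelt_eq0[-> /(sandwich_eq0 r0 p0)->].
rewrite S0 scaler0 addr0 => /eqP; rewrite qmul_eq0 -qdot_eq0 qdot_conj qdot_eq0.
rewrite (negPf p0) => /eqP/(sandwich_eq0 r0 s0)->.
rewrite al0 mulr0 addr0 => /eqP; rewrite mulf_eq0 (negPf n0) => /eqP->.
rewrite ze0 scaler0 addr0 => /eqP; rewrite scaler_eq0 (negPf m0).
by move=> /eqP/(sandwich_eq0 r0 s0)->.
Qed.

Lemma qbil_connected : connected_aut T.
Proof.
apply: (@aut_joined_connected _ _ (diag_end (q1 R) (q1 R) (q1 R))) => f fa.
have [p [r [s [p0 r0 s0 Ff]]]] := aut_joined_diag fa.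
apply: aut_joined_trans (diag_joined p0 r0 s0).
exact: connected_component_sym.
Qed.

(* The automorphism multiplying X and Y by 2 acts on n / n^2 as the scalar 2. *)
Lemma qbil_D1_neq1 :
  exists2 f : 'End(T), alg_aut f & D1 (two_step_nil (qbil R)) f != 1.
Proof.
pose n := two_step_nil (qbil R); have wn : weil_algebra n := two_step_weil _.
have q10 := q1_neq0 R; pose two := 2 *: q1 R.
have two0 : two != 0 by rewrite scaler_eq0 negb_or pnatr_eq0.
(* With p = 2 and r = s = 1, X is scaled by |r|^2 p = 2, Y by p^* = 2, and R e + Z by |p|^2 = 4. *)
pose f := diag_end two (q1 R) (q1 R).
have fa : alg_aut f by exact: diag_aut.
have conj1 : qconj (q1 R) = q1 R.
  by apply: quatP; rewrite /qconj /q1 !qE ?oppr0.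
have conj2 : qconj two = two by apply: quatP; rewrite /qconj /two /q1 !qE ?mulr0 ?oppr0.
have sand s x : sandwich (q1 R) s x = qmul x s.
  by rewrite /sandwich conj1 qmul1q qmulq1.
have scale4 : qscale two (q1 R) = 4.
  by rewrite /qscale /qdot /two /q1 !qE; ring.
have fE a x y e z :
    f (qelt a x y e z) = qelt a (2 *: x) (2 *: y) (4 * e) (4 *: z).
  rewrite diag_endE /diag_fun /= !sand scale4 qdot11 conj2 /two.
  by rewrite !qmulZr !qmulZl !qmulq1 qmul1q mul1r.
have n_elt (u : T) : u \in n -> u = qelt 0 u.1.2.1 u.1.2.2 u.2.1 u.2.2.
  by rewrite memv_two_step_nil => /eqP u0; rewrite {1}[u]qelt_eta u0.
have elt_n x y e z : qelt 0 x y e z \in n by rewrite memv_two_step_nil.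
have nn e z : qelt 0 0 0 e z \in (n * n)%VS.
  (* The part e comes from a product in X X and the part z from 1 z in X Y. *)
  have -> : qelt 0 0 0 e z = qelt 0 (e *: q1 R) 0 0 0 * qelt 0 (q1 R) 0 0 0
      + qelt 0 (q1 R) 0 0 0 * qelt 0 0 z 0 0 :> T.
    rewrite !qelt_mul0 qdot0 !qmulq0 qmul1q qeltD !(addr0, add0r).
    by rewrite -{1}[e]mulr1 -(qdot11 R) (qdotC _ (q1 R)) (linear_scale (qdotP _)).
  by rewrite memvD // memv_mul.
exists f => //; rewrite /D1.
have -> : quotv_lfun n (n * n)%VS f = 2 *: \1%VF.
  apply/lfunP => q; have [qn <-] := quotv_class_surj q.
  rewrite quotv_lfun_aut // scale_lfunE id_lfunE -linearZ /=; apply/eqP.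
  have fq : f (vsval q) - 2 *: vsval q \in (n * n)%VS.
    rewrite (n_elt _ qn) fE -scaleNr qeltZ qeltD mulr0 addr0.
    by rewrite -!scalerDl subrr !scale0r; exact: nn.
  have nn_n : (n * n <= n)%VS.
    apply/prodvP => u v /n_elt-> /n_elt->; rewrite qelt_mul0; exact: elt_n.
  by rewrite -subr_eq0 -linearB /= quotv_class_eq0 // (subvP nn_n).
rewrite lfun_det_scale.
suff d0 : (0 < \dim {:quotv n (n * n)})%N.
  by rewrite gt_eqF // exprn_egt1 ?ltr1n // -lt0n.
rewrite lt0n dimv_eq0; apply/eqP => quot0.
have : quotv_class n (n * n)%VS (qelt 0 (q1 R) 0 0 0) \in 0%VS.
  by rewrite -quot0 memvf.
rewrite memv0 quotv_class_eq0 //.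
(* The quotient is nonzero because [f] acts as 4 on n^2 but as 2 on X, so the unit of X is not in
   n^2. *)
have nn4 : (n * n <= lker (f - 4 *: \1%VF))%VS.
  apply/prodvP => u v /n_elt-> /n_elt->; rewrite qelt_mul0 memv_ker.
  rewrite add_lfunE opp_lfunE scale_lfunE id_lfunE fE qeltZ.
  by rewrite !mulr0 !scaler0 subrr.
move=> /(subvP nn4); rewrite memv_ker add_lfunE opp_lfunE scale_lfunE id_lfunE fE.
rewrite -scaleNr qeltZ qeltD => /eqP/qelt_eq0[_ /eqP + _ _ _].
rewrite -scalerDl scaler_eq0 (negPf q10) orbF.
by rewrite subr_eq0 eqr_nat.
Qed.

End quaternionic_connected.

Theorem mainTheorem1 (R : realType) :
  (forall (A : falgType R) (n : {vspace A}),
     weil_algebra n -> connected_aut A ->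
     (forall phi : 'End(A), alg_aut phi -> D1 n phi = 1) \/
     [set D1 n phi | phi in @alg_aut R A] = [set x : R | 0 < x]) /\
  (exists (A : falgType R) (n : {vspace A}),
     [/\ weil_algebra n, connected_aut A &
         forall phi : 'End(A), alg_aut phi -> D1 n phi = 1]) /\
  (exists (A : falgType R) (n : {vspace A}),
     [/\ weil_algebra n, connected_aut A &
         [set D1 n phi | phi in @alg_aut R A] = [set x : R | 0 < x]]).
Proof.
split; first exact: D1_dichotomy.
split.
  exists (two_step (zero_bil R)), (two_step_nil (zero_bil R)).
  split; [exact: two_step_weil | exact: zero_bil_connected |].
  by move=> f /zero_bil_aut->; apply: D1_id; exact: two_step_weil.
exists (two_step (qbil R)), (two_step_nil (qbil R)).
split; [exact: two_step_weil | exact: qbil_connected |].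
have [|//] := D1_dichotomy (two_step_weil (qbil R)) (@qbil_connected R).
by have [f fa /eqP f1] := qbil_D1_neq1 R => /(_ f fa).
Qed.
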